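(* Let $G$ be a graph with a universal node $u$ (a node adjacent to all other nodes of $G$). If the graph $G'$ obtained from $G$ by removing $u$ is a PCG, then $G$ is a 2-interval PCG.
   Context: Graphs are finite and simple. For a tree $T$ with non-negative real edge weights whose leaves are identified with the nodes of a graph, $d_T(u,v)$ denotes the weighted distance in $T$ between the leaves associated to $u$ and $v$. A graph $G=(V,E)$ is a PCG (pairwise compatibility graph) if there exist a tree $T$ with non-negative real edge weights, a bijection between $V$ and the leaves of $T$, and an interval $I$ of the non-negative real half-line such that for distinct $u,v\in V$, $(u,v)\in E$ if and only if $d_T(u,v)\in I$. A graph is a 2-interval PCG if the same holds with two disjoint intervals $I_1,I_2$ of the non-negative real half-line in place of $I$, with the condition $d_T(u,v)\in I_1\cup I_2$. *)

(* Defs.v *)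
From HB Require Import structures.
From mathcomp Require Import all_boot all_order all_algebra.
From mathcomp Require Import classical_sets reals.

Set Implicit Arguments.
Unset Strict Implicit.
Unset Printing Implicit Defensive.

Import Order.TTheory GRing.Theory Num.Theory.
Local Open Scope ring_scope.

Record sgraph := SGraph {
  svertex :> finType;
  sedge : rel svertex;
  sedge_sym : symmetric sedge;
  sedge_irrefl : irreflexive sedge }.

Definition universal (G : sgraph) (u : G) : Prop :=
  forall v : G, v != u -> sedge u v.

Section Induced.
Variables (G : sgraph) (S : {set G}).

Definition induced_rel : rel {x : G | x \in S} :=
  fun x y => sedge (val x) (val y).

Lemma induced_rel_sym : symmetric induced_rel.
Proof. by move=> x y; exact: sedge_sym. Qed.

Lemma induced_rel_irrefl : irreflexive induced_rel.
Proof. by move=> x; exact: sedge_irrefl. Qed.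

Definition induced : sgraph := SGraph induced_rel_sym induced_rel_irrefl.
End Induced.

Definition remove_node (G : sgraph) (u : G) : sgraph := induced [set~ u].

(* [ucycle] also holds of the closed walks [:: x; y] with x adjacent to y;    *)
(* the graph-theoretic cycles are those of length at least 3.                 *)
Definition is_tree (T : sgraph) : Prop :=
  [/\ (0 < #|T|)%N,
      forall x y : T, connect (@sedge T) x y
    & forall c : seq T, (2 < size c)%N -> ~ ucycle (@sedge T) c].

(* Values of [weight] outside the edges of the tree are irrelevant.           *)
Record wtree (R : realType) := WTree {
  wtree_graph :> sgraph;
  wtree_is_tree : is_tree wtree_graph;
  weight : wtree_graph -> wtree_graph -> R;
  weight_sym : forall x y, weight x y = weight y x;
  weight_ge0 : forall x y, sedge x y -> 0 <= weight x y }.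

(* Degree at most 1 instead of exactly 1: the node of a one-node tree is a    *)
(* leaf, so that the one-node graph is a PCG.                                 *)
Definition leaf (T : sgraph) : pred T :=
  fun x => (#|[set y | sedge x y]| <= 1)%N.

Definition simple_path (T : sgraph) (x y : T) (p : seq T) : Prop :=
  [/\ path (@sedge T) x p, uniq (x :: p) & last x p = y].

(* In a tree exactly one [p] satisfies [simple_path x y p]; the default value *)
(* [::] is never used. The starting node x is not listed in p.                *)
Definition tree_path (T : sgraph) (x y : T) : seq T :=
  xget [::] [set p | simple_path x y p]%classic.

Definition tree_dist (R : realType) (T : wtree R) (x y : T) : R :=
  \sum_(d <- pairmap (@weight R T) x (tree_path x y)) d.

Definition leaf_bijection (V : finType) (T : sgraph) (f : V -> T) : Prop :=
  injective f /\ codom f =i @leaf T.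

(* [interval R] contains intervals of all kinds (open, closed, half-open,     *)
(* unbounded), but also empty ones, which are excluded here.                  *)
Definition halfline_interval (R : realType) (I : interval R) : Prop :=
  (exists x : R, x \in I) /\ (forall x : R, x \in I -> 0 <= x).

Definition is_PCG (R : realType) (G : sgraph) : Prop :=
  exists (T : wtree R) (f : G -> T) (I : interval R),
    [/\ leaf_bijection f,
        halfline_interval I
      & forall u v : G, u != v ->
          sedge u v <-> tree_dist (f u) (f v) \in I].

Definition is_2interval_PCG (R : realType) (G : sgraph) : Prop :=
  exists (T : wtree R) (f : G -> T) (I1 I2 : interval R),
    [/\ leaf_bijection f,
        halfline_interval I1 /\ halfline_interval I2,
        forall x : R, ~ (x \in I1 /\ x \in I2)
      & forall u v : G, u != v ->
          sedge u v <->
          tree_dist (f u) (f v) \in I1 \/ tree_dist (f u) (f v) \in I2].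

(* Main.v *)
(* The new node [u] is hung as a leaf from an internal node of the tree of    *)
(* [G'], by an edge longer than every distance in that tree. Distances to [u] *)
(* then lie in a half-line beyond all the old distances, and the interval of  *)
(* [G'] is truncated so as to avoid this half-line. A tree without internal   *)
(* node has at most two nodes, and then a star with leaves [G] does the job.  *)
Require Import Defs.
From mathcomp Require Import all_boot all_order all_algebra.
From mathcomp Require Import classical_sets reals.

Set Implicit Arguments.
Unset Strict Implicit.
Unset Printing Implicit Defensive.

Import Order.TTheory GRing.Theory Num.Theory.
Local Open Scope ring_scope.

(** Simple paths in a tree are unique ([simple_path_inj]), so exhibiting one computes [tree_dist].
    Hanging a new leaf at an internal node [c] by an edge of length $l$ therefore keeps the old
    distances ([add_wleaf_dist]) and the old leaves ([leaf_add_leaf_Some]), and puts the new leaf at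
    distance $l + d(c,y) \ge l$ from each old node $y$ ([add_wleaf_dist_from]). With $l = D + 1$,
    where $D$ bounds all old distances, the half-line from $D + 1$ captures exactly the pairs
    containing [u], as universality demands, and the old interval cut at $D$ decides the other pairs
    as before.

    If all nodes of the tree are leaves, hanging a leaf could turn an old leaf into an internal
    node. But then the tree has at most two nodes ([all_leaf_node_eq]), so [G] has at most three,
    and in a suitable star [u] is at one distance from all other nodes while the only remaining
    pair, if any, is at another. *)

(** * Uniqueness of paths in a tree *)

Section TreePaths.
Variable T : sgraph.

(** Once the common beginning is stripped, the paths leave [x] by different neighbours. Both reach
    [y], so they meet again, and the portions up to the first meeting, one of them reversed, form a
    cycle. *)
Lemma simple_path_inj (x y : T) (p q : seq T) : is_tree T ->
  simple_path x y p -> simple_path x y q -> p = q.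
Proof.
move=> [_ _ acyclic].
elim: p x q => [|a p IHp] x [|b q] [pp up lp] [pq uq lq] //.
- by move: uq; rewrite [x]lp -lq /= mem_last.
- by move: up; rewrite [x]lq -lp /= mem_last.
have [eq_ab | neq_ab] := eqVneq a b.
  subst b; congr (_ :: _); apply: (IHp a) => //.
    by case/andP: pp => _ ?; case/andP: up.
  by case/andP: pq => _ ?; case/andP: uq.
have hasq : has (mem (b :: q)) (a :: p).
  have yp : y \in a :: p by rewrite -lp /= mem_last.
  have yq : y \in b :: q by rewrite -lq /= mem_last.
  by apply/hasP; exists y.
exfalso; move: neq_ab pp up {lp lq IHp}.
(* Stated through heads, the divergence survives generalizing and splitting both lists; they are
   nonempty, so the default [x] is never returned. *)
have -> : (a != b) = (head x (a :: p) != head x (b :: q)) by [].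
move: (a :: p) (b :: q) hasq uq pq => {a b p q} p q hasq uq pq neq_ab.
move: neq_ab; case/split_find: hasq => z p1 p2 /= zq p1q.
rewrite cat_rcons.
case/splitPr: q / zq uq pq p1q => q1 q2 uq pq p1q neq_ab pp up.
(* the two paths diverge at [x] and first meet again at [z]                   *)
apply: (acyclic (x :: rcons p1 z ++ rev q1)).
  rewrite /= size_cat size_rcons size_rev.
  (* If [p1] and [q1] were both empty, both paths would step from [x] to [z]; hence the cycle has a
     third node. *)
  by case: p1 q1 neq_ab {p1q uq pq pp up} => [|? ?] [|? ?] //=; rewrite ?eqxx ?addnS.
apply/andP; split; last first.
  move: up uq p1q.
  rewrite /= !mem_cat !cat_uniq rev_uniq !mem_rev !rcons_uniq !mem_rcons !inE /=.
  rewrite !negb_or => /and5P[/and3P[-> -> _] -> /andP[-> _] _ _].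
  move=> /and5P[/and3P[-> _ _] -> /andP[zq1 _] _ _] /hasPn p1q /=.
  rewrite andbT; apply/hasPn => t; rewrite mem_rev mem_rcons inE => tq1.
  apply/norP; split; first by apply: contraNneq zq1 => <-.
  by apply: contraL tq1 => /p1q; rewrite /= mem_cat negb_or => /andP[].
move: pp pq; rewrite -!cat_rcons !cat_path => /andP[pp _] /andP[pq _].
rewrite /= -cats1 -catA cat_path pp last_rcons cats1 -rev_cons -(belast_rcons x q1 z).
rewrite -[z in path _ z](last_rcons x q1 z) rev_path.
by rewrite (eq_path (e' := @sedge T)) // => ? ?; rewrite sedge_sym.
Qed.

Lemma tree_pathP (x y : T) : is_tree T -> simple_path x y (tree_path x y).
Proof.
move=> [_ conn _]; apply: (@xgetPex _ _ (simple_path x y)).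
have /connectP[p pp ->] := conn x y.
by case/shortenP: pp => q pq uq _; exists q.
Qed.

Lemma tree_pathE (x y : T) (p : seq T) :
  is_tree T -> simple_path x y p -> tree_path x y = p.
Proof. by move=> treeT; apply: simple_path_inj => //; exact: tree_pathP. Qed.
End TreePaths.

Lemma tree_dist_ge0 (R : realType) (T : wtree R) (x y : T) :
  0 <= tree_dist x y.
Proof.
have [pp _ _] := tree_pathP x y (wtree_is_tree T).
move: pp; rewrite /tree_dist; move: (tree_path x y) => p.
elim: p x => [|a p IHp] x /=.
  by rewrite big_nil.
by case/andP=> xa pp; rewrite big_cons addr_ge0 ?weight_ge0 ?IHp.
Qed.

(** * Hanging a leaf on a tree *)

Section AddLeaf.
Variables (T : sgraph) (c : T).

Definition add_leaf_rel : rel (option T) := fun x y =>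
  match x, y with
  | Some a, Some b => sedge a b
  | Some a, None | None, Some a => a == c
  | None, None => false
  end.

Lemma add_leaf_sym : symmetric add_leaf_rel.
Proof. by move=> [a|] [b|] //=; exact: sedge_sym. Qed.

Lemma add_leaf_irrefl : irreflexive add_leaf_rel.
Proof. by move=> [a|] //=; exact: sedge_irrefl. Qed.

Definition add_leaf : sgraph := SGraph add_leaf_sym add_leaf_irrefl.

Lemma path_add_leaf (x : T) (p : seq T) :
  path (@sedge add_leaf) (Some x) (map Some p) = path (@sedge T) x p.
Proof. by rewrite (map_path (e' := @sedge T) (b := pred0)) //; apply/hasPn. Qed.

Lemma add_leaf_simple_path (x y : T) (p : seq T) :
  simple_path x y p -> @simple_path add_leaf (Some x) (Some y) (map Some p).
Proof.
move=> [pp up lp]; split; rewrite ?path_add_leaf //; last by rewrite last_map lp.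
by rewrite -map_cons map_inj_uniq // => ? ? [].
Qed.

Lemma add_leaf_simple_path_from (y : T) (p : seq T) :
  simple_path c y p ->
  @simple_path add_leaf None (Some y) (Some c :: map Some p).
Proof.
move=> /add_leaf_simple_path[pp up lp]; split=> //=; first by rewrite eqxx.
by rewrite cons_uniq -map_cons in up *; rewrite up andbT; apply/mapP => -[].
Qed.

Lemma add_leaf_simple_path_to (x : T) (p : seq T) :
  simple_path x c p ->
  @simple_path add_leaf (Some x) None (rcons (map Some p) None).
Proof.
move=> /add_leaf_simple_path[pp up lp]; split; last by rewrite last_rcons.
  by rewrite rcons_path pp lp /= eqxx.
by rewrite -rcons_cons rcons_uniq up andbT -map_cons; apply/mapP => -[].
Qed.

Lemma add_leaf_tree : is_tree T -> is_tree add_leaf.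
Proof.
move=> treeT; have [_ conn acyclic] := treeT; split.
- by rewrite card_option.
- have simple_connect (x y : add_leaf) p : simple_path x y p ->
      connect (@sedge add_leaf) x y.
    by case=> pp _ lp; apply/connectP; exists p.
  move=> [x|] [y|]; last exact: connect0.
  + exact: simple_connect (add_leaf_simple_path (tree_pathP x y treeT)).
  + exact: simple_connect (add_leaf_simple_path_to (tree_pathP x c treeT)).
  + exact: simple_connect (add_leaf_simple_path_from (tree_pathP c y treeT)).
- move=> s s_gt2 /andP[cs us].
  have [Ns|Ns] := boolP (None \in s).
    (* both neighbours of [None] on a cycle would be [Some c]                 *)
    case/rot_to: Ns => i s' s'E.
    move: s_gt2 cs us; rewrite -(size_rot i) -(rot_cycle i) -(rot_uniq i) s'E.
    case: s' {s'E} => [|[a|] s'] //=; case/lastP: s' => [|s' [b|]] // _.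
      rewrite rcons_path last_rcons => /andP[/eqP-> /andP[_ /eqP->]].
      by rewrite mem_rcons mem_head andbF.
    by rewrite inE mem_rcons mem_head.
  have [t sE] : exists t : seq T, s = map Some t.
    exists (pmap id s); elim: s Ns {s_gt2 cs us} => // -[a|] s IHs //=.
    by rewrite inE /= => /IHs {1}->.
  apply: (acyclic t); first by rewrite sE size_map in s_gt2.
  apply/andP; split; last by move: us; rewrite sE map_inj_uniq // => ? ? [].
  move: cs; rewrite sE; case: t {sE} => //= a t.
  by rewrite -map_rcons path_add_leaf.
Qed.

Lemma leaf_add_leaf_None : @leaf add_leaf None.
Proof.
rewrite /leaf (_ : [set y | _] = [set Some c]) ?cards1 //.
by apply/setP => -[a|]; rewrite !inE //= eqE.
Qed.

(** Only the degree of [c] grows, and [c] already has two neighbours. *)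
Lemma leaf_add_leaf_Some (x : T) :
  ~~ leaf c -> @leaf add_leaf (Some x) = leaf x.
Proof.
move=> Nc; have injS : injective (@Some T) by move=> ? ? [].
have sub : Some @: [set y | sedge x y] \subset
    [set y | @sedge add_leaf (Some x) y].
  by apply/fintype.subsetP => _ /imsetP[y + ->]; rewrite !inE.
have [eq_xc | neq_xc] := eqVneq x c.
  rewrite eq_xc (negbTE Nc); apply: contraNF Nc => leafc.
  apply: leq_trans leafc; move: (subset_leq_card sub).
  by rewrite card_imset // eq_xc.
rewrite /leaf -(card_imset _ injS); congr (#|pred_of_set _| <= 1)%N.
apply/eqP; rewrite finset.eqEsubset sub andbT; apply/fintype.subsetP => -[y|].
  by rewrite inE => xy; apply: imset_f; rewrite inE.
by rewrite inE /= (negbTE neq_xc).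
Qed.

End AddLeaf.

(** * Distances after hanging a leaf *)

Section AddWeightedLeaf.
Variables (R : realType) (T : wtree R) (c : T) (l : R).
Hypothesis l_ge0 : 0 <= l.

Definition add_leaf_weight (x y : add_leaf c) : R :=
  if x is Some a then if y is Some b then weight a b else l else l.

Lemma add_leaf_weight_sym x y : add_leaf_weight x y = add_leaf_weight y x.
Proof. by case: x y => [a|] [b|] //=; exact: weight_sym. Qed.

Lemma add_leaf_weight_ge0 x y : sedge x y -> 0 <= add_leaf_weight x y.
Proof. by case: x y => [a|] [b|] //=; exact: weight_ge0. Qed.

Definition add_wleaf : wtree R :=
  WTree (add_leaf_tree c (wtree_is_tree T)) add_leaf_weight_sym
    add_leaf_weight_ge0.

Let map_weight (x : T) (p : seq T) :
  pairmap (@weight R add_wleaf) (Some x) (map Some p) =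
  pairmap (@weight R T) x p.
Proof. by elim: p x => //= a p IHp x; rewrite IHp. Qed.

Lemma add_wleaf_dist (x y : T) :
  @tree_dist R add_wleaf (Some x) (Some y) = tree_dist x y.
Proof.
rewrite /tree_dist (tree_pathE (wtree_is_tree add_wleaf)
  (add_leaf_simple_path c (tree_pathP x y (wtree_is_tree T)))).
by rewrite map_weight.
Qed.

Lemma add_wleaf_dist_from (y : T) :
  @tree_dist R add_wleaf None (Some y) = l + tree_dist c y.
Proof.
rewrite /tree_dist (tree_pathE (wtree_is_tree add_wleaf)
  (add_leaf_simple_path_from (tree_pathP c y (wtree_is_tree T)))).
by rewrite /= big_cons map_weight.
Qed.

Lemma add_wleaf_dist_to (x : T) :
  @tree_dist R add_wleaf (Some x) None = tree_dist x c + l.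
Proof.
have pP := tree_pathP x c (wtree_is_tree T).
rewrite /tree_dist (tree_pathE (wtree_is_tree add_wleaf)
  (add_leaf_simple_path_to pP)).
case: pP => _ _ lp; rewrite -cats1 pairmap_cat big_cat map_weight /= big_seq1.
by rewrite last_map lp.
Qed.

End AddWeightedLeaf.

(** * Weighted stars *)

Section Star.
Variable V : finType.

Definition star_rel : rel (option V) := fun x y => isSome x (+) isSome y.

Lemma star_sym : symmetric star_rel.
Proof. by move=> x y; exact: addbC. Qed.

Lemma star_irrefl : irreflexive star_rel.
Proof. by move=> x; exact: addbb. Qed.

Definition star : sgraph := SGraph star_sym star_irrefl.

(** A closed walk alternates between the centre [None] and the other nodes, so its length is even,
    and from length 3 on it visits the centre twice. *)
Lemma star_tree : is_tree star.
Proof.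
split; first by rewrite card_option.
  have cN (x : star) : connect (@sedge star) x None.
    by case: x => [a|]; rewrite ?connect0 // connect1.
  move=> x y; apply: connect_trans (cN x) _.
  by rewrite (sym_connect_sym star_sym).
case=> [|x [|y [|z s]]] //= _ /andP[].
case: x y z => [x|] [y|] [z|] //=.
by case: s => [|[s|] s'] //=; rewrite !inE /= ?orbT ?andbF.
Qed.

Lemma leaf_star_Some (x : V) : @leaf star (Some x).
Proof.
rewrite /leaf (_ : [set y | _] = [set None]) ?cards1 //.
by apply/setP => -[a|]; rewrite !inE.
Qed.

Lemma leaf_star_None : (1 < #|V|)%N -> ~~ @leaf star None.
Proof.
move=> V_gt1; rewrite /leaf -ltnNge (_ : [set y | _] = Some @: [set: V]).
  by rewrite card_imset ?cardsT // => ? ? [].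
by apply/setP => -[a|]; rewrite !inE /= ?imset_f //; apply/esym/imsetP => -[].
Qed.

Variables (R : realType) (w : V -> R).
Hypothesis w_ge0 : forall x, 0 <= w x.

(** On the edge joining the centre to [Some x] this is [w x]; the sum makes symmetry immediate. *)
Definition star_weight (x y : star) : R := oapp w 0 x + oapp w 0 y.

Lemma star_weight_sym x y : star_weight x y = star_weight y x.
Proof. exact: addrC. Qed.

Lemma star_weight_ge0 x y : sedge x y -> 0 <= star_weight x y.
Proof. by rewrite /star_weight; case: x y => [a|] [b|] //= _; rewrite addr_ge0. Qed.

Definition wstar : wtree R := WTree star_tree star_weight_sym star_weight_ge0.

Lemma wstar_dist (x y : V) : x != y ->
  @tree_dist R wstar (Some x) (Some y) = w x + w y.
Proof.
move=> neq_xy; rewrite /tree_dist (@tree_pathE star _ _ [:: None; Some y]).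
- by rewrite /= big_cons big_seq1 /star_weight /= addr0 add0r.
- exact: star_tree.
- by split; rewrite //= !inE /= (inj_eq Some_inj) neq_xy.
Qed.

End Star.

(** * Trees without internal node, and the two cases of the theorem *)

(** The node [x] and its neighbours form a set closed under adjacency, since a neighbour of [x] has
    no other neighbour. By connectedness this set is the whole tree, and [x] has at most one
    neighbour. *)
Lemma all_leaf_node_eq (T : sgraph) (x y z : T) :
  is_tree T -> (forall t : T, leaf t) -> y != x -> z != x -> y = z.
Proof.
move=> [_ conn _] all_leaf yx zx.
have nbr_eq (s t t' : T) : sedge s t -> sedge s t' -> t = t'.
  by move=> st st'; apply: (card_le1_eqP (all_leaf s)); rewrite inE.
have adj : forall t : T, t != x -> sedge x t.
  have clo : closed (@sedge T) [pred t | (t == x) || sedge x t].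
    apply: intro_closed => [s t|]; first exact: sym_connect_sym (@sedge_sym T) s t.
    move=> s t st; rewrite !inE => /orP[/eqP<-|xs]; first by rewrite st orbT.
    rewrite sedge_sym in xs.
    by rewrite (nbr_eq _ _ _ st xs) eqxx.
  move=> t tx; have := closed_connect clo (conn x t).
  by rewrite !inE eqxx (negbTE tx) => /esym.
exact: nbr_eq (adj y yx) (adj z zx).
Qed.

Theorem theorem1 (R : realType) (G : sgraph) (u : G)
  (hu : universal u) (hG' : is_PCG R (remove_node u)) :
  is_2interval_PCG R G.
Proof.
case: hG' => T [f [I [[f_inj f_leaf] [[a aI] I_ge0] fI]]].
have inG' (v : G) : v != u -> v \in [set~ u] by rewrite !inE.
have [c Nc|all_leaf] := pickP (predC (@leaf T)).
  (* A crude bound: each distance is one of the non-negative summands. The term [a], a point of [I],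
     keeps [I] cut at [D] nonempty. *)
  pose D := a + \sum_(p : T * T) tree_dist p.1 p.2.
  have D_ge (x y : T) : tree_dist x y <= D.
    rewrite /D (bigD1 (x, y)) //= addrCA lerDl addr_ge0 ?(I_ge0 a aI) //.
    by apply: sumr_ge0 => p _; exact: tree_dist_ge0.
  have aD : a <= D.
    by rewrite lerDl; apply: sumr_ge0 => p _; exact: tree_dist_ge0.
  have D_ge0 : 0 <= D by apply: le_trans aD; exact: I_ge0.
  have l_ge0 : 0 <= D + 1 by rewrite addr_ge0.
  pose T' := add_wleaf c l_ge0.
  (* [insub] fails exactly at [u], which thus goes to the new leaf [None]. *)
  pose f' (v : G) : T' := omap f (insub v).
  have f'u : f' u = None by rewrite /f' insubN // !inE eqxx.
  have f'E (v : G) (vu : v != u) : f' v = Some (f (Sub v (inG' v vu))).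
    by rewrite /f' insubT ?inG' //= => ?; congr (Some (f _)); exact: val_inj.
  exists T', f', (Order.meet I `]-oo, D]), `[D + 1, +oo[.
  split.
  - split.
      move=> v w; have [->|vu] := eqVneq v u; have [->|wu] := eqVneq w u => //.
      + by rewrite f'u f'E.
      + by rewrite f'u f'E.
      + by rewrite !f'E => -[/f_inj /(congr1 val)].
    move=> [x|].
      rewrite -[RHS]/(@leaf (add_leaf c) (Some x)) leaf_add_leaf_Some //.
      rewrite -[RHS]f_leaf; apply/codomP/codomP.
        move=> [v]; have [->|vu] := eqVneq v u; first by rewrite f'u.
        by rewrite f'E => -[->]; eexists.
      move=> [v ->]; exists (val v).
      have vu : val v != u by have := valP v; rewrite !inE.
      by rewrite f'E; congr (Some (f _)); exact: val_inj.
    rewrite -[RHS]/(@leaf (add_leaf c) None) leaf_add_leaf_None.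
    by apply/codomP; exists u.
  - split; split.
    + by exists a; rewrite in_itvI aI in_itv.
    + by move=> x; rewrite in_itvI => /andP[/I_ge0].
    + by exists (D + 1); rewrite in_itv /= lexx.
    + by move=> x; rewrite in_itv /= andbT; exact: le_trans.
  - move=> x; rewrite in_itvI !in_itv /= andbT => -[/andP[_ xD] Dx].
    by have := le_trans Dx xD; rewrite gerDl ler10.
  - move=> v w; have [->|vu] := eqVneq v u; have [->|wu] := eqVneq w u.
    + by [].
    + move=> _; rewrite f'u f'E add_wleaf_dist_from hu //; split=> // _; right.
      by rewrite in_itv /= andbT lerDl tree_dist_ge0.
    + move=> _; rewrite f'u f'E add_wleaf_dist_to sedge_sym hu //.
      by split=> // _; right; rewrite in_itv /= andbT lerDr tree_dist_ge0.
    + move=> vw; rewrite !f'E add_wleaf_dist.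
      have := fI (Sub v (inG' v vu)) (Sub w (inG' w wu)) vw.
      rewrite /= /induced_rel /= => ->; rewrite in_itvI !in_itv /= D_ge !andbT.
      split; first by left.
      case=> // Dd; have := le_trans Dd (D_ge _ _).
      by rewrite gerDl ler10.
have {}all_leaf (t : T) : leaf t by have /= := all_leaf t; case: leaf.
(* The bound of two nodes passes from the tree to $G'$ by injectivity of [f]. *)
have only_two (v w z : G) : v != u -> w != u -> z != u ->
    w != v -> z != v -> w = z.
  move=> vu wu zu wv zv; pose g x xu := f (Sub x (inG' x xu)).
  have gI x y xu yu : x != y -> g x xu != g y yu.
    by apply: contraNneq => /f_inj /(congr1 val) /= ->.
  have /f_inj /(congr1 val) // := all_leaf_node_eq (wtree_is_tree T) all_leaf
    (gI _ _ wu vu wv) (gI _ _ zu vu zv).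
have G_gt1 : (1 < #|G|)%N.
  have [/card_gt0P[t _] _ _] := wtree_is_tree T.
  have := all_leaf t; rewrite -[leaf t]/(t \in @leaf T) -f_leaf.
  case/codomP=> v _; have vu : val v != u by have := valP v; rewrite !inE.
  by apply/card_gt1P; exists (val v), u.
(* At most one pair of nodes avoids [u], so a single boolean records the adjacency in $G'$. *)
pose E := [exists v, [exists w, [&& v != u, w != u & sedge v w]]].
have sedgeE v w : v != u -> w != u -> v != w -> sedge v w = E.
  move=> vu wu vw; apply/idP/existsP => [sv|[x /existsP[y /and3P[xu yu xy]]]].
    by exists v; apply/existsP; exists w; rewrite vu wu.
  have neq_xy : x != y by apply: contraTneq xy => ->; rewrite sedge_irrefl.
  rewrite eq_sym in vw; have [eq_xv|xv] := eqVneq x v.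
    by rewrite -eq_xv (only_two v w y) // -eq_xv eq_sym.
  rewrite (only_two v w x) //; have [eq_yv|yv] := eqVneq y v.
    by rewrite -eq_yv sedge_sym.
  by rewrite (only_two v x y) ?eqxx in neq_xy.
(* Star distances become 3 + 2 = 5 from [u] and 2 + 2 = 4 between other nodes. *)
pose w (x : G) : R := if x == u then 3 else 2.
have w_ge0 x : 0 <= w x by rewrite /w; case: ifP.
(* The interval reduced to [e] must be nonempty even when $G'$ has no edge; 3 is not a distance
   between distinct leaves. *)
pose e : R := if E then 4 else 3.
exists (wstar w_ge0), Some, `[e, e], `[5, 5]; split.
- split; first exact: Some_inj.
  move=> [x|].
    rewrite -[RHS]/(@leaf (star G) (Some x)) leaf_star_Some.
    by apply/codomP; exists x.
  rewrite -[RHS]/(@leaf (star G) None).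
  by rewrite (negbTE (leaf_star_None G_gt1)); apply/codomP => -[].
- have e_ge0 : 0 <= e by rewrite /e; case: ifP.
  split; split.
  + by exists e; rewrite in_itv /= lexx.
  + by move=> x; rewrite in_itv /= => /andP[ex _]; exact: le_trans ex.
  + by exists 5; rewrite in_itv /= lexx.
  + by move=> x; rewrite in_itv /= => /andP[ex _]; exact: le_trans ex.
- move=> x; rewrite !in_itv /= -!eq_le => -[/eqP<-].
  by rewrite /e; case: ifP; rewrite eqr_nat.
- move=> v z vz; rewrite wstar_dist // !in_itv /= -!eq_le.
  have [vu|vu] := eqVneq v u.
    have zu : z != u by rewrite -vu eq_sym.
    rewrite vu hu // /w eqxx (negbTE zu) -natrD; split=> // _.
    by right.
  have [zu|zu] := eqVneq z u.
    rewrite zu sedge_sym hu // /w eqxx (negbTE vu) -natrD; split=> // _.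
    by right.
  rewrite sedgeE // /w (negbTE vu) (negbTE zu) -natrD !eqr_nat /e.
  by case: (E); rewrite eqr_nat; split=> //; [left | case].
Qed.
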